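(* Let $X$ be a Baire space and $Y$ a metric space with metric $\rho$. The uniform convergence space $(\mathcal{M}(X,Y),\Upsilon)$ is complete: every filter $\mathcal{F}$ on $\mathcal{M}(X,Y)$ which is Cauchy, i.e. satisfies $\mathcal{F}\times\mathcal{F}\in\Upsilon$, converges to some $f\in\mathcal{M}(X,Y)$.
   Context: For a Hausdorff space $Z$, a set-valued map $g:X\to Z$ is usco if $g(x)$ is a nonempty compact subset of $Z$ for each $x\in X$ and $\{x\in X: g(x)\subset U\}$ is open in $X$ for each open $U\subset Z$. Set-valued maps are identified with their graphs ($h\subset g$ means $h(x)\subset g(x)$ for all $x$). A usco map $g$ is minimal if $h=g$ for every usco $h\subset g$. $\mathcal{M}(X,Z)$ is the set of minimal usco maps from $X$ to $Z$, and for a usco map $g:X\to Z$, $[g]=\{f\in\mathcal{M}(X,Z):f\subset g\}$. A usco map $g$ is quasiminimal if $[g]$ has exactly one element. No separation axioms are assumed on $X$. A filter $\mathcal{F}$ on $\mathcal{M}(X,Z)$ is bounded if $[g]\in\mathcal{F}$ for some usco $g:X\to Z$. It converges to $f\in\mathcal{M}(X,Z)$ if it is bounded and $\{f\}=\bigcap\{[g]:g \text{ usco},[g]\in\mathcal{F}\}$. (For $Z=Y$ this convergence coincides with the one induced by $\Upsilon$, namely $\langle f\rangle\times\mathcal{F}\in\Upsilon$, where $\langle f\rangle$ is the filter generated by $\{\{f\}\}$.) For $f,g\in\mathcal{M}(X,Y)$, the map $f\times g:X\to Y\times Y$, $(f\times g)(x)=f(x)\times g(x)$, is a quasiminimal usco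 map (since $X$ is Baire and $Y$ metric), and $\chi:\mathcal{M}(X,Y)\times\mathcal{M}(X,Y)\to\mathcal{M}(X,Y\times Y)$ is defined by $\{\chi(f,g)\}=[f\times g]$. For a filter $\mathcal{U}$ on $\mathcal{M}(X,Y)\times\mathcal{M}(X,Y)$, $\chi(\mathcal{U})$ is the filter generated by $\{\chi(U):U\in\mathcal{U}\}$. For a usco map $\phi:X\to Y\times Y$, $\rho\circ\phi:X\to\mathbb{R}$ is the usco map $(\rho\circ\phi)(x)=\{\rho(y_1,y_2):(y_1,y_2)\in\phi(x)\}$. $\Upsilon$ is the family of all filters $\mathcal{U}$ on $\mathcal{M}(X,Y)\times\mathcal{M}(X,Y)$ such that the filter $\chi(\mathcal{U})$ is bounded in $\mathcal{M}(X,Y\times Y)$, and the filter generated by $\{[\rho\circ\phi]:\phi \text{ usco},\ [\phi]\in\chi(\mathcal{U})\}$ converges in $\mathcal{M}(X,\mathbb{R})$ to the constant function $0$ (regarded as the map $x\mapsto\{0\}$). $\mathcal{F}_1\times\mathcal{F}_2$ denotes the filter generated by $\{F_1\times F_2:F_1\in\mathcal{F}_1,F_2\in\mathcal{F}_2\}$. *)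

(* Defs.v *)
From HB Require Import structures.
From mathcomp Require Import all_boot all_order all_algebra.
From mathcomp Require Import all_classical all_reals all_analysis.
Import numFieldNormedType.Exports.

Set Implicit Arguments.
Unset Strict Implicit.
Unset Printing Implicit Defensive.

Local Open Scope classical_set_scope.
Local Open Scope ring_scope.

Definition baire_space (X : topologicalType) : Prop :=
  forall O : nat -> set X, (forall n, open (O n) /\ dense (O n)) ->
    dense (\bigcap_n O n).

Definition submap (X Z : Type) (h g : X -> set Z) : Prop :=
  forall x, h x `<=` g x.

(* Only used for Hausdorff Z (metric spaces and their squares). *)
Definition usco (X Z : topologicalType) (g : X -> set Z) : Prop :=
  [/\ forall x, g x !=set0, forall x, compact (g x) &
      forall U : set Z, open U -> open [set x | g x `<=` U]].

Definition minimal_usco (X Z : topologicalType) (g : X -> set Z) : Prop :=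
  usco g /\ forall h : X -> set Z, usco h -> submap h g -> h = g.

Record minusco (X Z : topologicalType) := MinUsco {
  minusco_map :> X -> set Z ;
  minuscoP : minimal_usco minusco_map }.

(* [g]; meant for usco g. *)
Definition minuscos_of (X Z : topologicalType) (g : X -> set Z) :
    set (minusco X Z) :=
  [set f | submap f g].

Definition bounded_filter (X Z : topologicalType)
    (F : set_system (minusco X Z)) : Prop :=
  exists2 g : X -> set Z, usco g & F (minuscos_of g).

Definition minusco_cvg (X Z : topologicalType)
    (F : set_system (minusco X Z)) (f : minusco X Z) : Prop :=
  bounded_filter F /\
  [set f] = \bigcap_(g in [set g | usco g /\ F (minuscos_of g)]) minuscos_of g.

Definition prod_map (X Z1 Z2 : Type) (f : X -> set Z1) (g : X -> set Z2) :
    X -> set (Z1 * Z2) :=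
  fun x => f x `*` g x.

(* The graph of the map chi, given by {chi(f, g)} = [f x g].  It is the graph
   of a total function when X is Baire and Y is metric, f x g being then
   quasiminimal. *)
Definition is_chi (X Y : topologicalType) (fg : minusco X Y * minusco X Y)
    (h : minusco X (Y * Y)%type) : Prop :=
  minuscos_of (prod_map fg.1 fg.2) = [set h].

Definition chi_image (X Y : topologicalType)
    (U : set (minusco X Y * minusco X Y)) : set (minusco X (Y * Y)%type) :=
  [set h | exists2 fg, U fg & is_chi fg h].

Definition chi_filter (X Y : topologicalType)
    (UU : set_system (minusco X Y * minusco X Y)) :
    set_system (minusco X (Y * Y)%type) :=
  smallest Filter [set chi_image U | U in UU].

Definition dist_map (R : realType) (X : Type) (Y : metricType R)
    (phi : X -> set (Y * Y)) : X -> set R :=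
  fun x => [set mdist yy.1 yy.2 | yy in phi x].

Lemma minimal_usco_cst (X Z : topologicalType) (c : Z) :
  minimal_usco (fun _ : X => [set c]).
Proof.
split; first split.
- by move=> x; exists c.
- by move=> x; exact: compact_set1.
- move=> U _; have [Uc|Uc] := pselect (U c).
    suff -> : [set _ : X | [set c] `<=` U] = setT by exact: openT.
    by rewrite -subTset => x _ _ ->.
  suff -> : [set _ : X | [set c] `<=` U] = set0 by exact: open0.
  by rewrite -subset0 => x /(_ c erefl).
- move=> h [h0 _ _] hc; apply/funext => x; apply/seteqP; split; first exact: hc.
  by have [z hz] := h0 x; move=> _ ->; rewrite -(hc _ _ hz).
Qed.

Definition minusco_cst (X Z : topologicalType) (c : Z) : minusco X Z :=
  MinUsco (@minimal_usco_cst X Z c).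

(* As usual for convergence structures, filters are proper. *)
Definition Upsilon (R : realType) (X : topologicalType) (Y : metricType R) :
    set (set_system (minusco X Y * minusco X Y)) :=
  [set UU | [/\ ProperFilter UU, bounded_filter (chi_filter UU) &
    minusco_cvg
      (smallest Filter
        [set minuscos_of (dist_map phi) | phi in
          [set phi : X -> set (Y * Y) |
            usco phi /\ chi_filter UU (minuscos_of phi)]])
      (minusco_cst X (0 : R))]].

(* Main.v *)
(* Minimality of a usco map f means that if f(x) meets an open set V and U
   is a neighbourhood of x, then f maps some nonempty open subset of U into
   V. Over a Baire space, f and g in M(X,Y) are thus simultaneously single-
   valued on a dense set, which makes f x g quasiminimal.

   Let F be Cauchy. If A in F and chi(A x A) is contained in [phi], then the
   second projection of phi bounds A, since the projection of chi(f,g) is a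
   usco map contained in g, hence g itself. The usco maps g with [g] in F
   then form a directed family, whose intersection is usco and contains a
   minimal f. If f' in M(X,Y) is contained in the same intersection, let k
   be a minimal usco map contained in f' x f. For A and phi as above, f' and
   f lie in the closure of the union of the graphs of the elements of A;
   shrinking open sets successively by means of k, an element of A and
   another element of A shows that k lies in phi. Hence rho o k lies in
   every rho o phi, so it contains the constant map 0 and f'(x) meets f(x)
   for every x, which forces f' = f by minimality. *)
Require Import Defs.
From mathcomp Require Import all_boot all_order all_algebra.
From mathcomp Require Import all_classical all_reals all_analysis.
From mathcomp Require Import lra.

Set Implicit Arguments.
Unset Strict Implicit.
Unset Printing Implicit Defensive.

Import Order.TTheory GRing.Theory Num.Theory.
Import numFieldNormedType.Exports.
Local Open Scope classical_set_scope.
Local Open Scope ring_scope.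

(** * Compactness, separation and continuity preliminaries *)

(** Near-covering form of compactness, applied along the small members of [F]. The filter is
    arbitrary because [usco_prod] uses one that is not a neighbourhood filter. *)
Lemma tube (I : Type) (F : set_system I) (Z : topologicalType) (K : set Z)
    (Q : set (I * Z)) : ProperFilter F -> compact K ->
    (forall z, K z -> filter_prod F (nbhs z) Q) ->
  exists V W, [/\ F V, open W, K `<=` W & V `*` W `<=` Q].
Proof.
move=> FF /compact_near_coveringP cK KQ.
have := cK _ (powerset_filter_from F)
  (fun V z => \forall z' \near z, forall i, V i -> Q (i, z'))
  (@powerset_filter_from_filter _ F FF).
case=> //.
  move=> z /KQ[[V N] /= [FV Nz] VNQ].
  exists (N°, [set V' | F V' /\ V' `<=` V]) => /=.
    by split; [exact: nbhs_interior|exact: powerset_filter_fromP].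
  move=> [z' V'] /= [Nz' [_ V'V]]; apply: filterS Nz' => t Nt i /V'V Vi.
  exact: VNQ.
move=> M [MF _ [V MV]] /(_ V MV) KV.
exists V, [set z | forall i, V i -> Q (i, z)]°; split; first exact: MF.
- exact: open_interior.
- exact: KV.
- by move=> [i z] /= [Vi /interior_subset]; exact.
Qed.

Lemma hausdorff_setX (Z1 Z2 : topologicalType) :
  hausdorff_space Z1 -> hausdorff_space Z2 -> hausdorff_space (Z1 * Z2)%type.
Proof.
move=> h1 h2 [a b] [c d] /= cl; congr pair.
- apply: h1 => A B aA cB.
  have [||[u v] [Au Bu]] := cl (A `*` setT) (B `*` setT).
  + by exists (A, setT) => //=; split=> //; exact: filterT.
  + by exists (B, setT) => //=; split=> //; exact: filterT.
  + by exists u; split; [exact: Au.1|exact: Bu.1].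
- apply: h2 => A B aA cB.
  have [||[u v] [Au Bu]] := cl (setT `*` A) (setT `*` B).
  + by exists (setT, A) => //=; split=> //; exact: filterT.
  + by exists (setT, B) => //=; split=> //; exact: filterT.
  + by exists v; split; [exact: Au.2|exact: Bu.2].
Qed.

Lemma mdist_continuous (R : realType) (Y : metricType R) :
  continuous (fun p : Y * Y => mdist p.1 p.2).
Proof.
move=> [a b]; apply/cvgrPdist_lt => e e0 /=.
exists (ball a (e / 2), ball b (e / 2)).
  by split=> /=; apply: nbhsx_ballx; rewrite divr_gt0.
move=> [c d] /=; rewrite !ballEmdist/= => -[ac bd].
have t1 := metric_triangle a c b; have t2 := metric_triangle c d b.
have t3 := metric_triangle c a d; have t4 := metric_triangle a b d.
rewrite (metric_sym d b) in t2; rewrite (metric_sym c a) in t3.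
rewrite ltr_norml; apply/andP; split; [lra|lra].
Qed.

(** * Usco maps: closed graphs, intersections and minimality *)

Section usco.
Variables X Z : topologicalType.
Implicit Types g h : X -> set Z.

Definition closed_graph g := closed [set p : X * Z | g p.1 p.2].

Lemma usco_nbhs g x (W : set Z) : usco g -> open W -> g x `<=` W ->
  \forall x' \near x, g x' `<=` W.
Proof.
by move=> [_ _ ug] oW gW; apply: open_nbhs_nbhs; split=> //; exact: ug.
Qed.

(** A point off [g x] is separated from each point of [g x]; a tube makes this uniform, and upper
    semicontinuity carries it to nearby [x']. *)
Lemma usco_closed_graph g : hausdorff_space Z -> usco g -> closed_graph g.
Proof.
move=> hZ ug [x y] /= cl; apply: contrapT => ngy.
have [_ cg _] := ug.
have [|V [W [yV oW gW VW]]] := @tube _ (nbhs y) _ _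
    [set p | p.1 != p.2] _ (cg x).
  move=> z gz; have yz : y != z by apply: contra_notN ngy => /eqP ->.
  move: hZ; rewrite open_hausdorff => /(_ _ _ yz)[[A B]] /=.
  rewrite !inE => -[Ay Bz] [oA oB AB0].
  exists (A, B) => /=; first by split; apply: open_nbhs_nbhs.
  move=> [s t] /= [As Bt]; apply/eqP => st.
  suff: set0 s by [].
  by rewrite -[set0]AB0; split=> //; rewrite st.
have : nbhs (x, y) ([set x' | g x' `<=` W] `*` V).
  by exists ([set x' | g x' `<=` W], V) => //; split=> //; exact: usco_nbhs.
move=> /cl[[s t] [/= gst [/= /(_ _ gst) Wt Vt]]].
by have /= := VW (t, t) (conj Vt Wt); rewrite eqxx.
Qed.

(** For upper semicontinuity, each point of [g x] is either in [h x], hence in [U], or gives a pair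
    off the closed graph of [h]; a tube around [g x] combines both cases. *)
Lemma usco_sub g h : usco g -> submap h g -> (forall x, h x !=set0) ->
  closed_graph h -> usco h.
Proof.
move=> ug hg h0 ch; have [_ cg _] := ug.
have clh x : closed (h x).
  move=> z clz; apply: (ch (x, z)) => B [[B1 B2] /= [xB zB] BB].
  have [t [ht Bt]] := clz _ zB.
  by exists (x, t); split=> //; apply: BB; split=> //=; exact: nbhs_singleton.
split=> //; first by move=> x; exact: subclosed_compact (cg x) (hg x).
move=> U oU; rewrite openE => x /= hU.
have [|V [W [xV oW gW VW]]] := @tube _ (nbhs x) _ _
    [set p | h p.1 p.2 -> U p.2] _ (cg x).
  move=> z gz; have [hz|nhz] := pselect (h x z).
    exists (setT, U) => /=; last by move=> [? ?] /= [_ ?] _.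
    by split; [exact: filterT|apply: open_nbhs_nbhs; split=> //; exact: hU].
  have : nbhs (x, z) (~` [set p : X * Z | h p.1 p.2]).
    by apply: open_nbhs_nbhs; split; [exact: (closed_openC ch)|exact: nhz].
  by apply: filterS => p np.
apply: filterS2 xV (usco_nbhs ug oW gW) => t Vt gt z hz.
by apply: (VW (t, z)) => //; split=> //; apply: gt; exact: hg.
Qed.

Lemma closed_graph_bigcap (G : set (X -> set Z)) :
  (forall g, G g -> closed_graph g) ->
  closed_graph (fun x => \bigcap_(g in G) g x).
Proof.
move=> cG; rewrite /closed_graph.
rewrite (_ : mkset _ = \bigcap_(g in G) [set p : X * Z | g p.1 p.2]) //.
exact: closed_bigI.
Qed.

(** Nonemptiness is the main point: the values at [x] generate a proper filter, which clusters in a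
    compact value, and the cluster point lies in every closed value. *)
Lemma usco_bigcap (G : set (X -> set Z)) : hausdorff_space Z -> G !=set0 ->
  (forall g, G g -> usco g) ->
  (forall g1 g2, G g1 -> G g2 ->
    exists2 g3, G g3 & submap g3 g1 /\ submap g3 g2) ->
  usco (fun x => \bigcap_(g in G) g x).
Proof.
move=> hZ [g0 Gg0] uG dG; apply: (@usco_sub g0); first exact: uG.
- by move=> x z; apply.
- move=> x; have [g00 cg0 _] := uG _ Gg0.
  have FG : ProperFilter (filter_from G (fun g => g x)).
    apply: filter_from_proper; last by move=> g /uG[].
    apply: filter_from_filter; first by exists g0.
    move=> g1 g2 G1 G2; have [g3 G3 [g31 g32]] := dG _ _ G1 G2.
    by exists g3 => //; rewrite subsetI; split; [exact: g31|exact: g32].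
  have [|z [_ clz]] := cg0 x _ FG; first by exists g0.
  exists z => g Gg; have [_ cg _] := uG _ Gg.
  have := compact_closed hZ (cg x); apply => B zB.
  by apply: clz => //; exists g.
- by apply: closed_graph_bigcap => g /uG; exact: usco_closed_graph.
Qed.

Lemma usco_cap g h : hausdorff_space Z -> usco g -> usco h ->
  (forall x, g x `&` h x !=set0) -> usco (fun x => g x `&` h x).
Proof.
move=> hZ ug uh gh0; apply: (usco_sub ug _ gh0); first by move=> x z [].
exact: closedI (usco_closed_graph hZ ug) (usco_closed_graph hZ uh).
Qed.

Lemma ex_minimal_usco g : hausdorff_space Z -> usco g ->
  exists h : minusco X Z, submap h g.
Proof.
move=> hZ ug; pose T := {h | usco h /\ submap h g}.
have [|||A tA|[m [um mg]] mmax] :=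
  @Zorn T (fun s t => `[< submap (sval t) (sval s) >]).
- by move=> t; apply/asboolP => x.
- move=> r s t /asboolP rs /asboolP st; apply/asboolP => x.
  exact: subset_trans (st x) (rs x).
- move=> [s ps] [t pt] /asboolP /= st /asboolP /= ts.
  by apply: eq_exist; apply/funext => x; apply/seteqP; split.
- have [A0|A0] := pselect (A !=set0); last first.
    (* The empty chain is bounded by [g]; an empty intersection would be the whole space. *)
    exists (exist _ g (conj ug (fun x => @subset_refl _ (g x)))).
    by move=> s As; case: A0; exists s.
  pose G := [set sval t | t in A].
  have uc : usco (fun x => \bigcap_(k in G) k x).
    apply: usco_bigcap => //.
    + by have [t At] := A0; exists (sval t); exists t.
    + by move=> _ [t At <-]; exact: (svalP t).1.
    + move=> _ _ [s As <-] [t At <-].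
      have [/asboolP st|/asboolP ts] := tA _ _ As At.
        by exists (sval t); [exists t|split=> // x].
      by exists (sval s); [exists s|split=> // x].
  have cg : submap (fun x => \bigcap_(k in G) k x) g.
    move=> x z Gz; have [t At] := A0; apply: (svalP t).2.
    by apply: Gz; exists t.
  exists (exist _ (fun x => \bigcap_(k in G) k x) (conj uc cg)) => s As.
  apply/asboolP => x z /=; apply.
  by exists s.
have mm : minimal_usco m.
  split=> // h uh hm.
  have hg : submap h g by move=> x; exact: subset_trans (hm x) (mg x).
  have /= mh := mmax (exist _ h (conj uh hg)) (asboolT hm).
  exact: (congr1 (fun t : T => sval t) mh).
by exists (MinUsco mm).
Qed.

Lemma minusco_sub (f : minusco X Z) h : usco h -> submap h f -> h = f.
Proof. by move=> uh hf; exact: (minuscoP f).2. Qed.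

Lemma minusco_usco (f : minusco X Z) : usco f.
Proof. exact: (minuscoP f).1. Qed.

Lemma minusco_eq (f g : minusco X Z) : f = g :> (X -> set Z) -> f = g.
Proof.
case: f g => f pf [g pg] /= fg; case: _ / fg pg => pg.
by rewrite (Prop_irrelevance pf pg).
Qed.

(** The pointwise intersection is a usco map inside both, so minimality identifies it with each. *)
Lemma minusco_meet_eq (f g : minusco X Z) : hausdorff_space Z ->
  (forall x, f x `&` g x !=set0) -> f = g.
Proof.
move=> hZ fg0; have u := usco_cap hZ (minusco_usco f) (minusco_usco g) fg0.
apply: minusco_eq; rewrite -(minusco_sub u); last by move=> x z [].
by apply: minusco_sub => // x z [].
Qed.

(* Otherwise removing V from the values of f over U gives a smaller usco map. *)
Lemma minusco_shrink (f : minusco X Z) (U : set X) (V : set Z) x :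
  hausdorff_space Z -> open U -> open V -> U x -> f x `&` V !=set0 ->
  exists U', [/\ open U', U' !=set0, U' `<=` U &
    forall x', U' x' -> f x' `<=` V].
Proof.
move=> hZ oU oV Ux [z [fz Vz]]; have uf := minusco_usco f.
suff [x' [Ux' fx']] : exists x', U x' /\ f x' `<=` V.
  exists (U `&` [set t | f t `<=` V]); split; last 2 first.
  - by move=> t [].
  - by move=> t [].
  - by apply: openI => //; have [_ _] := uf; exact.
  - by exists x'.
apply: contrapT => /forallNP nUV.
pose h t := f t `&` ~` [set s | U t /\ V s].
have uh : usco h.
  apply: (@usco_sub f) => //.
  - by move=> t s [].
  - move=> t; have [Ut|nUt] := pselect (U t); last first.
      by have [/(_ t)[s fs] _ _] := uf; exists s; split=> // -[].
    have /existsNP[s /not_implyP[fs nVs]] : ~ (f t `<=` V).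
      by move=> fV; apply: (nUV t).
    by exists s; split=> // -[].
  - have oUV : open (U `*` V).
      rewrite openE => -[a b] [/= Ua Vb].
      by exists (U, V) => //; split; apply: open_nbhs_nbhs.
    exact: closedI (usco_closed_graph hZ uf) (open_closedC oUV).
have hf : h = f by apply: minusco_sub => // t s [].
by move: fz; rewrite -hf => -[_]; apply.
Qed.

(** Disjointness of [f x] and [g x] would persist on a neighbourhood of [x], which [D] meets. *)
Lemma minusco_eq_dense (f g : minusco X Z) (D : set X) : hausdorff_space Z ->
  dense D -> (forall x, D x -> f x `&` g x !=set0) -> f = g.
Proof.
move=> hZ dD fg; apply: minusco_meet_eq => // x; apply: contrapT.
move=> /nonemptyPn fg0; have uf := minusco_usco f; have [_ cf _] := uf.
have [|V [W [xV oW fW VW]]] := @tube _ (nbhs x) _ _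
    [set p : X * Z | ~ g p.1 p.2] _ (cf x).
  move=> z fz.
  suff : nbhs (x, z) (~` [set p : X * Z | g p.1 p.2]) by [].
  apply: open_nbhs_nbhs; split.
    exact: closed_openC (usco_closed_graph hZ (minusco_usco g)).
  by move=> gz; suff: set0 z by []; rewrite -[set0]fg0.
have : nbhs x (V `&` [set x' | f x' `<=` W]).
  by apply: filterI => //; exact: usco_nbhs.
rewrite nbhsE => -[A [oA Ax] AV].
have [|t [At Dt]] := dD A _ oA; first by exists x.
have [z [fz gz]] := fg _ Dt; have [Vt ft] := AV _ At.
by apply: (VW (t, z)) => //; split=> //; exact: ft.
Qed.

End usco.

(** * Images and products of usco maps *)

Lemma usco_image (X Z W : topologicalType) (k : Z -> W) (g : X -> set Z) :
  continuous k -> usco g -> usco (fun x => k @` g x).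
Proof.
move=> ck [g0 cg ug]; split.
- by move=> x; have [z gz] := g0 x; exists (k z); exists z.
- move=> x; apply: continuous_compact (cg x).
  exact: continuous_subspaceT.
- move=> U oU; rewrite (_ : mkset _ = [set x | g x `<=` k @^-1` U]).
    by apply: ug; move/continuousP: ck; exact.
  apply/seteqP; split=> x /= gU; first by move=> z gz; apply: gU; exists z.
  by move=> _ [z gz <-]; exact: gU.
Qed.

Lemma usco_prod (X Z1 Z2 : topologicalType) (g1 : X -> set Z1)
    (g2 : X -> set Z2) : usco g1 -> usco g2 -> usco (prod_map g1 g2).
Proof.
move=> ug1 ug2; have [g10 cg1 _] := ug1; have [g20 cg2 _] := ug2; split.
- by move=> x; have [y gy] := g10 x; have [z gz] := g20 x; exists (y, z).
- by move=> x; exact: compact_setX.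
move=> U oU; rewrite openE => x /= gU.
(* [F] consists of the sets that contain [g1 x'] for all [x'] near [x]. A tube around [g1 x] for
   each fixed [z], then one around [g2 x] along [F], yield a box inside [U]. *)
pose F := [set S | \forall x' \near x, g1 x' `<=` S].
have FF : ProperFilter F.
  split.
    move=> F0; have /nbhs_singleton := F0.
    by have [y gy] := g10 x => /(_ _ gy).
  split=> [|A B|A B AB]; first by apply: nearW => t.
  - apply: (@filterS2 _ (nbhs x) _ [set t | g1 t `<=` A] [set t | g1 t `<=` B]).
    by move=> t /= tA tB; rewrite subsetI.
  - apply: (@filterS _ (nbhs x) _ [set t | g1 t `<=` A]) => t /= tA.
    exact: subset_trans AB.
have [|V [W [FV oW gW VW]]] := @tube _ F _ _ U FF (cg2 x).
  move=> z gz.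
  have [|V [W [zV oW gW VW]]] :=
      @tube _ (nbhs z) _ _ [set p | U (p.2, p.1)] _ (cg1 x).
    move=> y gy.
    have [[A B] /= [yA zB] AB] : nbhs (y, z) U.
      by apply: open_nbhs_nbhs; split=> //; exact: gU.
    by exists (B, A) => // -[s t] /= [Bs At]; apply: AB.
  exists (W, V); last by move=> [s t] [/= Ws Vt]; apply: (VW (t, s)).
  by split=> //; exact: usco_nbhs.
have FV' : \forall t \near x, g1 t `<=` V := FV.
apply: filterS2 FV' (usco_nbhs ug2 oW gW) => t tV tW [y z] [/= gy gz].
by apply: VW; split; [exact: tV|exact: tW].
Qed.

(** * Quasiminimality of products over a Baire space *)

Section small_values.
Variables (R : realType) (X : topologicalType) (Y : metricType R).
Implicit Types f g : minusco X Y.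

(** As [e] decreases to 0, these sets shrink to the points where [f] is single-valued. Taking
    interiors lets upper semicontinuity make them open. *)
Definition small_values f e : set X :=
  [set x | exists y, f x `<=` (ball y e)°].

Lemma open_small_values f e : open (small_values f e).
Proof.
rewrite (_ : small_values f e = \bigcup_y [set x | f x `<=` (ball y e)°]).
  apply: bigcup_open => y _; have [_ _ uf] := minusco_usco f.
  by apply: uf; exact: open_interior.
by apply/seteqP; split=> x [y] => [fy|_ fy]; exists y.
Qed.

Lemma dense_small_values f e : 0 < e -> dense (small_values f e).
Proof.
move=> e0 U [x Ux] oU; have [/(_ x)[y fy] _ _] := minusco_usco f.
have [|U' [_ [x' Ux'] UU' fU']] := @minusco_shrink _ _ f U (ball y e)° x
    (@metric_hausdorff _ Y) oU (@open_interior _ _) Ux.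
  by exists y; split=> //; exact: nbhsx_ballx.
by exists x'; split; [exact: UU'|exists y; exact: fU'].
Qed.

Lemma open_dense_small_values f g e : 0 < e ->
  open (small_values f e `&` small_values g e) /\
  dense (small_values f e `&` small_values g e).
Proof.
by move=> e0; split; [apply: openI|apply: denseI => //];
  first [exact: open_small_values|exact: dense_small_values].
Qed.

Lemma small_values_eq f x y z : (forall n, small_values f n.+1%:R^-1 x) ->
  f x y -> f x z -> y = z.
Proof.
move=> fx fy fz; apply: contrapT => /eqP; rewrite -mdist_gt0 => yz.
have yz2 : 0 < mdist y z / 2 by rewrite divr_gt0.
(* A ball of radius below half the distance cannot contain both [y] and [z]. *)
have [n _ /(_ n (leqnn n)) /= nyz] := near_infty_natSinv_lt (PosNum yz2).
have [w fw] := fx n.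
have := interior_subset (fw _ fy); have := interior_subset (fw _ fz).
rewrite !ballEmdist /= in nyz * => wz wy.
have t := metric_triangle y w z; rewrite (metric_sym y w) in t.
by move: n.+1%:R^-1 nyz wz wy => r; lra.
Qed.

(** Two minimal usco maps inside the product both take the only available value on the dense set
    where [f] and [g] are single-valued, so they coincide. *)
Lemma ex_chi f g : baire_space X -> exists h, is_chi (f, g) h.
Proof.
move=> bX.
have hYY := hausdorff_setX (@metric_hausdorff _ Y) (@metric_hausdorff _ Y).
have ufg := usco_prod (minusco_usco f) (minusco_usco g).
have [h hfg] := ex_minimal_usco hYY ufg.
exists h; apply/seteqP; split=> [h' h'fg|_ -> //].
have e0 n : 0 < n.+1%:R^-1 :> R by rewrite invr_gt0.
have dD := bX _ (fun n => open_dense_small_values f g (e0 n)).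
apply: (minusco_eq_dense hYY dD) => x Dx.
have [/(_ x)[p h'p] _ _] := minusco_usco h'.
have [/(_ x)[q hq] _ _] := minusco_usco h.
exists p; split=> //; suff -> : p = q by [].
have [fp gp] := h'fg _ _ h'p; have [fq gq] := hfg _ _ hq.
have fx n : small_values f n.+1%:R^-1 x by have [] := Dx n I.
have gx n : small_values g n.+1%:R^-1 x by have [] := Dx n I.
rewrite [p]surjective_pairing [q]surjective_pairing.
congr pair; first exact: small_values_eq fx fp fq.
exact: small_values_eq gx gp gq.
Qed.

End small_values.

(** The supersets of the images already form a filter, since the image of an intersection lies in
    both images. *)
Lemma chi_filterP (X Y : topologicalType)
    (UU : set_system (minusco X Y * minusco X Y)) A :
  Filter UU -> chi_filter UU A -> exists2 U, UU U & chi_image U `<=` A.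
Proof.
move=> FU; suff : chi_filter UU `<=` filter_from UU (@chi_image X Y) by exact.
apply: smallest_sub; last by move=> _ [U UUU <-]; exists U.
apply: filter_from_filter; first by exists setT; exact: filterT.
move=> U V UUU UUV; exists (U `&` V); first exact: filterI.
by move=> h [fg [Ufg Vfg] fgh]; split; exists fg.
Qed.

(** * Closures of unions of graphs *)

Section graph_closure.
Variables X Z : topologicalType.
Implicit Types A : set (minusco X Z).

(** For Hausdorff [Z], this is the least usco bound of a nonempty [A] that has one. *)
Definition graph_closure A : X -> set Z := fun x =>
  [set z | closure [set p | exists2 f, A f & f p.1 p.2] (x, z)].

Lemma sub_graph_closure A : A `<=` minuscos_of (graph_closure A).
Proof. by move=> f Af x z fz; apply: subset_closure; exists f. Qed.

Lemma usco_graph_closure A g : hausdorff_space Z -> A !=set0 -> usco g ->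
  A `<=` minuscos_of g -> usco (graph_closure A).
Proof.
move=> hZ [f Af] ug Ag; apply: (usco_sub ug).
- move=> x z clz; apply: (@usco_closed_graph _ _ _ hZ ug (x, z)).
  by apply: closureS clz => -[s t] [f' Af' f't]; exact: Ag f't.
- move=> x; have [/(_ x)[z fz] _ _] := minusco_usco f; exists z.
  exact: sub_graph_closure fz.
- rewrite /closed_graph.
  rewrite (_ : mkset _ = closure [set p | exists2 f, A f & f p.1 p.2]).
    exact: closed_closure.
  by apply/seteqP; split=> -[].
Qed.

(** A point of the graph of [f] over [U] is approximated by a point of the graph of some [g] in [A],
    to which [minusco_shrink] applies. *)
Lemma graph_closure_shrink A (f : minusco X Z) (U : set X) (V : set Z) :
  hausdorff_space Z -> submap f (graph_closure A) -> open U -> open V ->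
  U !=set0 -> (forall x, U x -> f x `<=` V) ->
  exists g U', [/\ A g, open U', U' !=set0, U' `<=` U &
    forall x, U' x -> g x `<=` V].
Proof.
move=> hZ fA oU oV [x Ux] fV; have [/(_ x)[z fz] _ _] := minusco_usco f.
have : nbhs (x, z) (U `*` V).
  exists (U, V) => //; split; apply: open_nbhs_nbhs; split=> //.
  exact: fV fz.
move=> /(fA _ _ fz)[[x' z'] [[g Ag /= gz'] [/= Ux' Vz']]].
have [|U' [oU' U'0 UU' gU']] := minusco_shrink hZ oU oV Ux' (f := g).
  by exists z'.
by exists g, U'.
Qed.

End graph_closure.

(** * Minimal usco maps into a product *)

Section prod_minusco.
Variables Z1 Z2 X : topologicalType.
Hypotheses (hZ1 : hausdorff_space Z1) (hZ2 : hausdorff_space Z2).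

(** The projection is a usco map inside the minimal map [f]. *)
Lemma minusco_fst (h : minusco X (Z1 * Z2)%type) (f : minusco X Z1) g :
  submap h (prod_map f g) -> (fun x => fst @` h x) = f.
Proof.
move=> hfg; apply: minusco_sub.
  by apply: usco_image (minusco_usco h); move=> p; exact: cvg_fst.
by move=> x _ [p hp <-]; exact: (hfg _ _ hp).1.
Qed.

Lemma minusco_snd (h : minusco X (Z1 * Z2)%type) f (g : minusco X Z2) :
  submap h (prod_map f g) -> (fun x => snd @` h x) = g.
Proof.
move=> hfg; apply: minusco_sub.
  by apply: usco_image (minusco_usco h); move=> p; exact: cvg_snd.
by move=> x _ [p hp <-]; exact: (hfg _ _ hp).2.
Qed.

(** As [phi] has a closed graph, it suffices to find a point of that graph in every neighbourhood of
    a point of the graph of [k]. *)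
Lemma prod_graph_closure_sub (A1 : set (minusco X Z1)) (A2 : set (minusco X Z2))
    (phi : X -> set (Z1 * Z2)) (f1 : minusco X Z1) (f2 : minusco X Z2)
    (k : minusco X (Z1 * Z2)%type) :
  usco phi ->
  (forall g1 g2, A1 g1 -> A2 g2 ->
    exists2 h : minusco X (Z1 * Z2)%type,
      submap h (prod_map g1 g2) & submap h phi) ->
  submap f1 (graph_closure A1) -> submap f2 (graph_closure A2) ->
  submap k (prod_map f1 f2) -> submap k phi.
Proof.
move=> uphi Aphi fA1 fA2 kf x [y1 y2] ky.
apply: (@usco_closed_graph _ _ _ (hausdorff_setX hZ1 hZ2) uphi (x, (y1, y2))).
move=> B [[U V] /= [xU [[V1 V2] /= [yV1 yV2] VV]] UB].
move: xU yV1 yV2; rewrite !nbhsE.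
move=> -[U0 [oU0 U0x] UU0] [W1 [oW1 W1y] VW1] [W2 [oW2 W2y] VW2].
have oW : open (W1 `*` W2).
  rewrite openE => -[a b] [/= Wa Wb].
  by exists (W1, W2) => //; split; apply: open_nbhs_nbhs.
(* Over [U1] all values of [k] lie in the box, so its projections [f1] and [f2] have their values in
   the sides. *)
have [|U1 [oU1 U10 U01 kU1]] :=
    minusco_shrink (hausdorff_setX hZ1 hZ2) oU0 oW U0x (f := k).
  by exists (y1, y2).
have fU1 t : U1 t -> f1 t `<=` W1.
  move=> U1t y; rewrite -(minusco_fst kf) => -[p kp <-].
  exact: (kU1 _ U1t _ kp).1.
have fU2 t : U1 t -> f2 t `<=` W2.
  move=> U1t y; rewrite -(minusco_snd kf) => -[p kp <-].
  exact: (kU1 _ U1t _ kp).2.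
(* [g2] is sought inside the open set found for [g1], so that over [U3] both are confined to the
   box, and with them the map [h] below [phi]. *)
have [g1 [U2 [Ag1 oU2 U20 U12 gU2]]] :=
  graph_closure_shrink hZ1 fA1 oU1 oW1 U10 fU1.
have [g2 [U3 [Ag2 oU3 [t U3t] U23 gU3]]] :=
  graph_closure_shrink hZ2 fA2 oU2 oW2 U20 (fun t Ut => fU2 t (U12 t Ut)).
have [h hg hphi] := Aphi _ _ Ag1 Ag2.
have [/(_ t)[p hp] _ _] := minusco_usco h; have [/= gp1 gp2] := hg _ _ hp.
exists (t, p); split; first exact: hphi.
apply: UB; split=> /=; first by apply: UU0; apply: U01; apply: U12; apply: U23.
apply: VV; split=> /=; first by apply: VW1; apply: gU2 gp1; exact: U23.
by apply: VW2; apply: gU3 gp2.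
Qed.

End prod_minusco.

(** * Convergence of Cauchy filters *)

Theorem theorem34 (R : realType) (X : topologicalType) (Y : metricType R)
    (F : set_system (minusco X Y)) :
  baire_space X -> ProperFilter F -> Upsilon (filter_prod F F) ->
  exists f : minusco X Y, minusco_cvg F f.
Proof.
move=> bX FF [_ [phi0 uphi0 bphi0] [_ cvg0]].
have hY := @metric_hausdorff _ Y; have hYY := hausdorff_setX hY hY.
have cauchy phi : chi_filter (filter_prod F F) (minuscos_of phi) ->
    exists2 A, F A & forall f g, A f -> A g ->
      exists2 h : minusco X (Y * Y)%type,
        submap h (prod_map f g) & submap h phi.
  move=> /chi_filterP[U [[A B] /= [FA FB] ABU] Uphi].
  (* Intersecting the sides of the rectangle gives one set controlling all pairs of its members. *)
  exists (A `&` B); first exact: filterI.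
  move=> f g [Af _] [_ Bg]; have [h fgh] := ex_chi f g bX.
  exists h; first by suff : minuscos_of (prod_map f g) h by []; rewrite fgh.
  by apply: Uphi; exists (f, g) => //; exact: ABU.
have [A0 FA0 A0phi] := cauchy _ bphi0.
pose g0 x := snd @` phi0 x.
have ug0 : usco g0 by apply: usco_image uphi0; move=> p; exact: cvg_snd.
have A0g0 : A0 `<=` minuscos_of g0.
  (* Pairing [g] with itself suffices: the second projection of the resulting map inside [phi0] is
     [g]. *)
  move=> g A0g x y; have [h hg hphi] := A0phi _ _ A0g A0g.
  rewrite -(minusco_snd hg) => -[p hp <-]; exists p => //; exact: hphi.
pose G := [set g | usco g /\ F (minuscos_of g)].
have Gg0 : G g0 by split=> //; exact: filterS FA0.
have uh : usco (fun x => \bigcap_(g in G) g x).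
  apply: usco_bigcap => //; [by exists g0|by move=> g []|].
  move=> g1 g2 [ug1 Fg1] [ug2 Fg2]; exists (fun x => g1 x `&` g2 x).
    have Fg : F (minuscos_of g1 `&` minuscos_of g2) by exact: filterI.
    split; last by apply: (filterS _ Fg) => f [fg1 fg2] x; rewrite subsetI.
    (* A common minimal submap shows that [g1] and [g2] meet at every point. *)
    have [f [fg1 fg2]] := filter_ex Fg.
    apply: usco_cap => // x; have [/(_ x)[y fy] _ _] := minusco_usco f.
    by exists y; split; [exact: fg1|exact: fg2].
  by split=> x y [].
have [f fh] := ex_minimal_usco hY uh.
have fG : (\bigcap_(g in G) minuscos_of g) f.
  by move=> g Gg x y /fh; exact.
exists f; split; first by exists g0; [|exact: Gg0.2].
apply/seteqP; split=> [_ -> //|f' f'G].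
have [k kf] :=
  ex_minimal_usco hYY (usco_prod (minusco_usco f') (minusco_usco f)).
have kphi phi : usco phi -> chi_filter (filter_prod F F) (minuscos_of phi) ->
    submap k phi.
  move=> uphi /cauchy[A FA Aphi].
  (* Intersecting with [A0] brings in the bound [g0], so the graph closure is usco, belongs to [G],
     and contains both [f'] and [f]. *)
  have Gcl : G (graph_closure (A `&` A0)).
    have FAA0 : F (A `&` A0) by exact: filterI.
    split; last by apply: filterS FAA0; exact: sub_graph_closure.
    apply: (usco_graph_closure hY (filter_ex FAA0) ug0).
    by move=> g [_ /A0g0].
  apply: (prod_graph_closure_sub hY hY uphi _ (f'G _ Gcl) (fG _ Gcl) kf).
  by move=> g1 g2 [Ag1 _] [Ag2 _]; exact: Aphi.
have [m mk] := ex_minimal_usco (@Rhausdorff R)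
  (usco_image (@mdist_continuous _ Y) (minusco_usco k)).
have m0 : m = minusco_cst X (0 : R).
  suff : [set minusco_cst X (0 : R)] m by [].
  rewrite cvg0 => g [_]; set SF := smallest _ _ => SFg.
  (* The sets containing [m] form a filter, which has every generator as a member because [m] lies
     in the distance map of [k], hence in that of [phi]. *)
  suff /(_ _ SFg) : SF `<=` [set S | S m] by [].
  apply: smallest_sub.
    by split=> // P Q; exact.
  move=> _ [phi [uphi cphi] <-] x r /mk[p kp <-]; exists p => //.
  exact: kphi.
(* A pair at distance 0 in [k x] is a point common to [f' x] and [f x]. *)
apply: (minusco_meet_eq hY) => x.
have [[y1 y2] ky y0] : [set mdist p.1 p.2 | p in k x] 0.
  by apply: mk; rewrite m0.
have [/= fy1 fy2] := kf _ _ ky.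
exists y1; split=> //; have /= -> := mdist_positivity _ _ y0; exact: fy2.
Qed.
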